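(* Let the Finsler space $F^N$ be conformally isomorphic to the Riemannian space $R^N=\{M,a_{mn}(x)\}$ by means of a fibrewise transformation $y\mapsto \zeta(x,y)$, positively homogeneous of degree $h(x)>0$ in $y$ and sending unit vectors to unit vectors, such that $$g_{mn}(x,y)=\varkappa^2\,\frac{\partial \zeta^i}{\partial y^m}\,\frac{\partial \zeta^j}{\partial y^n}\,a_{ij}(x),\qquad \varkappa=\frac1hK^{1-h}.$$ Then the indicatrix supported by a point $x\in M$ is of constant curvature $\mathcal C(x)$ with $$\mathcal C(x)=h^2(x).$$
   Context: $M$ is an $N$-dimensional differentiable manifold with local coordinates $x^i$, and $y^i$ are the induced components of tangent vectors $y\in T_xM$. The Finsler space $F^N$ is given by a Finsler metric function $K(x,y)>0$ on $TM\setminus 0$ (positively homogeneous of degree 1 in $y$ and strongly convex), with metric tensor $g_{mn}=\frac12\,\partial^2K^2/\partial y^m\partial y^n$. $a_{mn}(x)$ is a Riemannian metric tensor on $M$ and $S(x,\zeta)=\sqrt{a_{mn}(x)\zeta^m\zeta^n}$. The fibrewise transformation is, for each $x\in M$, a diffeomorphism $y\mapsto\zeta(x,y)$ between open regions of $T_xM\setminus\{0\}$ (invariant under multiplication by positive numbers), of class $C^5$ in $y$ and $C^4$ in $x$. Homogeneity means $\zeta^i(x,\gamma y)=\gamma^{h(x)}\zeta^i(x,y)$ for all $\gamma>0$; sending unit vectors to unit vectors means $K(x,y)=1$ if and only if $S(x,\zeta(x,y))=1$. The indicatrix supported by $x$ is the hypersurface $\{y\in T_xM: K(x,y)=1\}$,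 endowed with the Riemannian metric induced from the tangent Riemannian space $(T_xM, g_{mn}(x,\cdot))$ ($x$ fixed); its curvature is the curvature of this induced metric. All considerations are local with respect to $y$ (they refer to the region where the transformation is defined). *)

(* Defs.v *)
From HB Require Import structures.
From mathcomp Require Import all_boot all_order all_algebra.
From mathcomp Require Import all_classical all_reals all_analysis.

Set Implicit Arguments.
Unset Strict Implicit.
Unset Printing Implicit Defensive.
Import Order.TTheory GRing.Theory Num.Theory.
Import numFieldNormedType.Exports.
Local Open Scope classical_set_scope.
Local Open Scope ring_scope.

(* C^k maps on an open set of a finite-dimensional space: in finite dimension,
   continuity of every directional derivative is continuity of the
   differential. *)
Fixpoint Ck {R : realType} {V W : normedModType R} (k : nat)
    (f : V -> W) (U : set V) : Prop :=
  if k is k'.+1 then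
    (forall x, U x -> differentiable f x) /\ (forall v, Ck k' ('D_v f) U)
  else forall x, U x -> {for x, continuous f}.

(* Only the values of [coord] on [dom], and of [point] on [coord @` dom],
   matter. *)
Record chart (R : realType) (N : nat) (M : topologicalType) := Chart {
  dom : set M ;
  coord : M -> 'rV[R]_N ;
  point : 'rV[R]_N -> M ;
  open_dom : open dom ;
  open_coord : open (coord @` dom) ;
  coordK : forall p, dom p -> point (coord p) = p ;
  coord_cts : forall p, dom p -> {for p, continuous coord} ;
  point_cts : forall x, (coord @` dom) x -> {for x, continuous point}
}.

Record smooth_manifold (R : realType) (N : nat) (M : topologicalType)
    (A : set (chart R N M)) : Prop := SmoothManifold {
  mfd_hausdorff : hausdorff_space M ;
  mfd_second_countable : @second_countable M ;
  mfd_cover : forall p, exists2 c, A c & dom c p ;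
  mfd_smooth : forall c d, A c -> A d ->
    forall k, Ck k (coord d \o point c) (coord c @` (dom c `&` dom d))
}.

(* A tangent vector at p is given by its induced components y in a chart around
   p; [tchange c d p] turns the components in c into the components in d.
   Accordingly, a geometric object on the tangent bundle is a family, indexed
   by the charts c, of its expressions in the coordinates of c, subject to the
   corresponding transformation law. *)
Definition tchange (R : realType) (N : nat) (M : topologicalType)
    (c d : chart R N M) (p : M) : 'rV[R]_N -> 'rV[R]_N :=
  'd (coord d \o point c) (coord c p).

Definition partial {R : realType} {n : nat} {W : normedModType R} (i : 'I_n)
    (f : 'rV[R]_n -> W) : 'rV[R]_n -> W :=
  'D_(delta_mx 0 i) f.

Definition bilin {R : realType} {n : nat} (G : 'M[R]_n) (v w : 'rV[R]_n) : R :=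
  \sum_m \sum_j G m j * v 0 m * w 0 j.

Definition posdef {R : realType} {n : nat} (G : 'M[R]_n) : Prop :=
  G^T = G /\ forall v, v != 0 -> 0 < bilin G v v.

Definition finsler_tensor (R : realType) (N : nat) (F : 'rV[R]_N -> R)
    (y : 'rV[R]_N) : 'M[R]_N :=
  \matrix_(m, n) (2^-1 * partial m (partial n (fun z => F z ^+ 2)) y).

Record finsler_metric (R : realType) (N : nat) (M : topologicalType)
    (A : set (chart R N M)) (K : chart R N M -> M -> 'rV[R]_N -> R) : Prop :=
  FinslerMetric {
  fin_change : forall c d p y, A c -> A d -> dom c p -> dom d p -> y != 0 ->
    K d p (tchange c d p y) = K c p y ;
  fin_cts : forall c p y, A c -> dom c p -> y != 0 ->
    {for (p, y), continuous (fun z : M * 'rV[R]_N => K c z.1 z.2)} ;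
  fin_C2 : forall c p, A c -> dom c p -> Ck 2 (K c p) [set y | y != 0] ;
  fin_pos : forall c p y, A c -> dom c p -> y != 0 -> 0 < K c p y ;
  fin_homog : forall c p y t, A c -> dom c p -> y != 0 -> 0 < t ->
    K c p (t *: y) = t * K c p y ;
  fin_convex : forall c p y, A c -> dom c p -> y != 0 ->
    posdef (finsler_tensor (K c p) y)
}.

Record riemannian_metric (R : realType) (N : nat) (M : topologicalType)
    (A : set (chart R N M)) (a : chart R N M -> M -> 'M[R]_N) : Prop :=
  RiemannianMetric {
  riem_change : forall c d p v w, A c -> A d -> dom c p -> dom d p ->
    bilin (a d p) (tchange c d p v) (tchange c d p w) = bilin (a c p) v w ;
  riem_cts : forall c p, A c -> dom c p -> {for p, continuous (a c)} ;
  riem_posdef : forall c p, A c -> dom c p -> posdef (a c p)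
}.

Definition riem_norm (R : realType) (N : nat) (G : 'M[R]_N) (v : 'rV[R]_N) : R :=
  Num.sqrt (bilin G v v).

Definition conic_region (R : realType) (N : nat) (U : set 'rV[R]_N) : Prop :=
  [/\ open U, ~ U 0 & forall t y, 0 < t -> U y -> U (t *: y)].

Definition Ck_diffeo (R : realType) (N k : nat) (f : 'rV[R]_N -> 'rV[R]_N)
    (U V : set 'rV[R]_N) : Prop :=
  exists g : 'rV[R]_N -> 'rV[R]_N,
    [/\ f @` U = V, forall y, U y -> g (f y) = y, Ck k f U & Ck k g V].

(* For each c and p, [D c p] is the region of T_pM on which zeta is defined.
   In [ft_C4], the components y are fixed and the coordinates x vary; the
   interior is taken because the regions are only assumed open in each tangent
   space, not as a subset of the tangent bundle. *)
Record fibrewise_transformation (R : realType) (N : nat) (M : topologicalType)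
    (A : set (chart R N M)) (D : chart R N M -> M -> set 'rV[R]_N)
    (zeta : chart R N M -> M -> 'rV[R]_N -> 'rV[R]_N) : Prop :=
  FibrewiseTransformation {
  ft_dom_change : forall c d p y, A c -> A d -> dom c p -> dom d p ->
    D c p y <-> D d p (tchange c d p y) ;
  ft_change : forall c d p y, A c -> A d -> dom c p -> dom d p -> D c p y ->
    zeta d p (tchange c d p y) = tchange c d p (zeta c p y) ;
  ft_region : forall c p, A c -> dom c p -> conic_region (D c p) ;
  ft_image_region : forall c p, A c -> dom c p ->
    conic_region (zeta c p @` D c p) ;
  ft_diffeo : forall c p, A c -> dom c p ->
    Ck_diffeo 5 (zeta c p) (D c p) (zeta c p @` D c p) ;
  ft_C4 : forall c y, A c ->
    Ck 4 (fun x => zeta c (point c x) y)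
      (interior [set x | (coord c @` dom c) x /\ D c (point c x) y])
}.

Section Curvature.
Variables (R : realType) (n : nat) (G : 'rV[R]_n -> 'M[R]_n).
Implicit Types (u X Y : 'rV[R]_n) (i j k l : 'I_n).

Definition christoffel l i j u : R :=
  2^-1 * \sum_k invmx (G u) l k *
    (partial i (fun v => G v k j) u + partial j (fun v => G v k i) u
     - partial k (fun v => G v i j) u).

(* R(d_i, d_j) d_k = \sum_l riemann l k i j d_l, with
   R(X, Y) = [nabla_X, nabla_Y] - nabla_[X, Y] *)
Definition riemann l k i j u : R :=
  partial i (christoffel l j k) u - partial j (christoffel l i k) u
  + \sum_m (christoffel l i m u * christoffel m j k u
            - christoffel l j m u * christoffel m i k u).

Definition curvature_op u X Y (Z : 'rV[R]_n) : 'rV[R]_n :=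
  \row_l \sum_i \sum_j \sum_k riemann l k i j u * X 0 i * Y 0 j * Z 0 k.

Definition sectional_curvature u X Y : R :=
  bilin (G u) (curvature_op u X Y Y) X /
  (bilin (G u) X X * bilin (G u) Y Y - bilin (G u) X Y ^+ 2).

End Curvature.

(* Regular local parametrization of a hypersurface Sigma of R^N; since Sigma
   has dimension N-1, an injective immersion into it is open. *)
Definition local_parametrization (R : realType) (N : nat)
    (Sigma : set 'rV[R]_N) (V : set 'rV[R]_N.-1)
    (sigma : 'rV[R]_N.-1 -> 'rV[R]_N) : Prop :=
  [/\ open V, Ck 3 sigma V, forall u, V u -> row_free ('J sigma u),
      forall u v, V u -> V v -> sigma u = sigma v -> u = v
    & sigma @` V `<=` Sigma].

Definition induced_metric (R : realType) (N n : nat)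
    (g : 'rV[R]_N -> 'M[R]_N) (sigma : 'rV[R]_n -> 'rV[R]_N)
    (u : 'rV[R]_n) : 'M[R]_n :=
  \matrix_(i, j) bilin (g (sigma u)) (partial i sigma u) (partial j sigma u).

Definition hypersurface_constant_curvature (R : realType) (N : nat)
    (g : 'rV[R]_N -> 'M[R]_N) (Sigma : set 'rV[R]_N) (C : R) : Prop :=
  forall (V : set 'rV[R]_N.-1) (sigma : 'rV[R]_N.-1 -> 'rV[R]_N),
    local_parametrization Sigma V sigma ->
    forall u X Y, V u -> row_free (col_mx X Y) ->
      sectional_curvature (induced_metric g sigma) u X Y = C.

Definition indicatrix (R : realType) (N : nat) (F : 'rV[R]_N -> R) :
    set 'rV[R]_N :=
  [set y | y != 0 /\ F y = 1].

(* Main.v *)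
Require Import Defs.
From HB Require Import structures.
From mathcomp Require Import all_boot all_order all_algebra.
From mathcomp Require Import all_classical all_reals all_analysis.
From mathcomp Require Import ring.
Set Implicit Arguments.
Unset Strict Implicit.
Unset Printing Implicit Defensive.
Import Order.TTheory GRing.Theory Num.Theory.
Import numFieldNormedType.Exports.
Local Open Scope classical_set_scope.
Local Open Scope ring_scope.

(** Fix [x] in [M]. On the indicatrix [K = 1], so the conformal factor [kappa]
    is the constant [1/h] there, and the hypothesis on the metric tensor says
    that the indicatrix metric is the pullback of the Euclidean scalar product
    [a x] by [psi = zeta / h]. Unit vectors go to unit vectors, so [psi] maps
    the indicatrix into the sphere of radius [1/h], whose curvature is [h^2].

    The curvature in question is an explicit formula in the coefficients of the
    induced metric, so the last fact is proved by a computation in a local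
    parametrization (section [Sphere]). Let [psi] be [C^3] with values in a
    Euclidean space of dimension [n + 1], with [<psi, psi> = 1/C], and let
    [G i j = <psi_i, psi_j>] be invertible, subscripts denoting partial
    derivatives. Differentiating [<psi, psi>] twice gives [<psi, psi_i> = 0] and
    [<psi, psi_ij> = - G i j], and the Christoffel symbols are the ones for which
    [<psi_ij, psi_k> = sum_l Gamma^l_ij G l k]. As [psi] and the [psi_l] form a
    frame, this determines [psi_ij] and gives the Gauss formula ([gauss])
      [psi_ij = sum_l Gamma^l_ij psi_l - C G_ij psi].
    Differentiating once more, and comparing the tangential components of
    [psi_ijk = psi_jik], yields
      [R^l_kij = C (G_jk delta_il - G_ik delta_jl)]  ([riemann_sphere]),
    and every sectional curvature is therefore [C].

    The analytic facts behind this are the stability of [C^k] maps under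
    composition ([Ck_comp]), since [psi] is read in a parametrization; the
    equality of mixed partial derivatives ([schwarz]); and the
    differentiability of the inverse of a matrix ([differentiable_invmx]), since
    the Christoffel symbols have to be differentiated. *)

(** * Maps of class C^k *)

(** Being differentiable at [x] depends only on the germ at [x]; this is what
    lets identities valid on an open set be differentiated. *)
Lemma near_eq_differentiable (R : realType) (V W : normedModType R)
    (f g : V -> W) (x : V) :
  {near x, f =1 g} -> differentiable f x -> differentiable g x.
Proof.
move=> fg df.
(* The differential of [g - f] at [x] exists and is zero: [g - f] vanishes
   around [x], hence is negligible with respect to the increment. *)
have dfg : g - f \o shift x = cst ((g - f) x) + 0 +o_ 0 id.
  apply/eqaddoP => e e0.
  have [d d0 xd] := (nbhs_ballP _ _).1 fg.
  apply/nbhs_ballP; exists d => //= t; rewrite -ball_normE /= sub0r normrN => td.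
  have gft : f (t + x) = g (t + x).
    by apply: xd; rewrite -ball_normE /= opprD addrCA subrr addr0 normrN.
  have gfx : f x = g x by apply: xd; exact: ballxx.
  rewrite !fctE /= gft gfx !subrr addr0 subr0 normr0.
  by rewrite mulr_ge0// ltW.
have c0 : continuous (\0 : {linear V -> W}) by exact: cst_continuous.
have dE := diff_unique c0 dfg.
have dgf : differentiable (g - f) x.
  by apply/diff_locallyP; rewrite dE; split => //; exact: cst_continuous.
rewrite (_ : g = (g - f) + f); last by apply/funext => t; rewrite !fctE subrK.
exact: differentiableD.
Qed.

Lemma near_open (T : topologicalType) (U : set T) (P : T -> Prop) (x : T) :
  open U -> U x -> (forall y, U y -> P y) -> \near x, P x.
Proof. by move=> oU Ux PU; apply: filterS PU _; exact: open_nbhs_nbhs. Qed.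

Section CkCalculus.
Context {R : realType} {V : normedModType R} (U : set V).
Hypothesis oU : open U.

(** [Ck k] involves directional derivatives as functions on the whole space, but
    on an open set only their values there count. This is the step that
    replaces ['D_v] of a sum, product or composite by its expansion, valid on [U]
    only, in the inductions below. *)
Lemma Ck_ext (W : normedModType R) k (f g : V -> W) :
  (forall x, U x -> f x = g x) -> Ck k f U -> Ck k g U.
Proof.
elim: k f g => [|k IH] f g fg /=.
  move=> cf x Ux; rewrite /prop_for /continuous_at -(fg x Ux).
  apply: cvg_trans (cf x Ux); apply: near_eq_cvg.
  exact: near_open (x) oU Ux fg.
move=> [df dvf]; split=> [x Ux|v].
  by apply: near_eq_differentiable (df x Ux); exact: near_open fg.
apply: IH (dvf v) => x Ux; apply: near_eq_derive; exact: near_open fg.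
Qed.

Lemma CkW (W : normedModType R) k (f : V -> W) : Ck k.+1 f U -> Ck k f U.
Proof.
elim: k f => [|k IH] f /= [df dvf].
  by move=> x /df; exact: differentiable_continuous.
by split=> // v; apply: IH; exact: dvf.
Qed.

Lemma Ck_cst (W : normedModType R) k (w : W) : Ck k (fun=> w) U.
Proof.
elim: k w => [|k IH] w /=; first by move=> x _; exact: cst_continuous.
split=> [x _|v]; first exact: differentiable_cst.
by apply: Ck_ext (IH 0) => x _; rewrite derive_cst.
Qed.

Lemma CkD (W : normedModType R) k (f g : V -> W) :
  Ck k f U -> Ck k g U -> Ck k (fun x => f x + g x) U.
Proof.
elim: k f g => [|k IH] f g /=.
  by move=> cf cg x Ux; apply: continuousD; [exact: cf|exact: cg].
move=> [df dvf] [dg dvg]; split=> [x Ux|v].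
  by apply: differentiableD; [exact: df|exact: dg].
apply: Ck_ext (IH _ _ (dvf v) (dvg v)) => x Ux; apply/esym.
by apply: deriveD; apply: diff_derivable; [exact: df|exact: dg].
Qed.

Lemma Ck_sum (W : normedModType R) k (I : Type) (r : seq I) (f : I -> V -> W) :
  (forall i, Ck k (f i) U) -> Ck k (fun x => \sum_(i <- r) f i x) U.
Proof.
move=> fU; elim: r => [|i r IH].
  by have := Ck_cst k (0 : W); apply: Ck_ext => x _; rewrite big_nil.
by apply: Ck_ext (CkD (fU i) IH) => x _; rewrite big_cons.
Qed.

Lemma CkM k (f g : V -> R) : Ck k f U -> Ck k g U -> Ck k (fun x => f x * g x) U.
Proof.
elim: k f g => [|k IH] f g fU gU.
  by move=> x Ux; apply: continuousM; [exact: fU|exact: gU].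
have [[df dvf] [dg dvg]] := (fU, gU).
split=> [x Ux|v].
  by apply: differentiableM; [exact: df|exact: dg].
have := CkD (IH _ _ (CkW fU) (dvg v)) (IH _ _ (CkW gU) (dvf v)).
apply: Ck_ext => x Ux; apply/esym.
by apply: deriveM; apply: diff_derivable; [exact: df|exact: dg].
Qed.

Lemma Ck_coord k m (f : V -> 'rV[R]_m) i : Ck k f U -> Ck k (fun x => f x 0 i) U.
Proof.
elim: k f => [|k IH] f /=.
  move=> cf x Ux.
  by apply: (@continuous_comp _ _ _ f (fun y : 'rV[R]_m => y 0 i)) => //;
     [exact: cf|exact: coord_continuous].
move=> [df dvf]; split=> [x Ux|v].
  apply: (differentiable_comp (g := fun y : 'rV[R]_m => y 0 i)); first exact: df.
  exact: differentiable_coord.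
apply: Ck_ext (IH _ (dvf v)) => x Ux.
by rewrite derive_mx ?mxE//; apply: diff_derivable; exact: df.
Qed.

Lemma derive_comp_partial m (g : 'rV[R]_m -> R) (f : V -> 'rV[R]_m) v x :
  differentiable f x -> differentiable g (f x) ->
  'D_v (g \o f) x = \sum_i 'D_v f x 0 i * partial i g (f x).
Proof.
move=> df dg; rewrite deriveE; last exact: differentiable_comp.
rewrite diff_comp//= -(deriveE v df) {1}[in LHS](row_sum_delta ('D_v f x)) linear_sum.
by apply: eq_bigr => i _; rewrite linearZ /partial (deriveE _ dg).
Qed.

(** Induction on [k]: by the chain rule, a directional derivative of the
    composite is a sum of products of coordinates of ['D_v f], of class [C^k], and
    of partial derivatives of [g] composed with [f], which are [C^k] by induction
    because they are one order below [g]. *)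
Lemma Ck_comp k m (W : set 'rV[R]_m) (g : 'rV[R]_m -> R) (f : V -> 'rV[R]_m) :
  (forall x, U x -> W (f x)) -> Ck k f U -> Ck k g W -> Ck k (g \o f) U.
Proof.
move=> fUW; elim: k g => [|k IH] g fU gW.
  move=> x Ux; apply: continuous_comp; first exact: fU.
  by apply: gW; exact: fUW.
have [[df dvf] [dg dvg]] := (fU, gW).
split=> [x Ux|v].
  by apply: differentiable_comp; [exact: df|apply: dg; exact: fUW].
have := @Ck_sum _ k _ (index_enum 'I_m) _
  (fun i => CkM (Ck_coord i (dvf v)) (IH _ (CkW fU) (dvg (delta_mx 0 i)))).
apply: Ck_ext => x Ux; rewrite derive_comp_partial//; first exact: df.
by apply: dg; exact: fUW.
Qed.

End CkCalculus.

(** * Mixed partial derivatives *)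

Section Schwarz.
Context {R : realType} {V : normedModType R}.
Implicit Types (f : V -> R) (x y v w : V).

Lemma is_derive_line f y v (s : R) : differentiable f (y + s *: v) ->
  is_derive s 1 (fun t : R => f (y + t *: v)) ('D_v f (y + s *: v)).
Proof.
move=> df; have fE : (fun h : R => h^-1 *: (((fun t : R => f (y + t *: v)) \o
    shift s) (h *: 1) - f (y + s *: v))) =
    (fun h => h^-1 *: ((f \o shift (y + s *: v)) (h *: v) - f (y + s *: v))).
  apply/funext => h /=; congr (_ *: (f _ - _)).
  by rewrite scalerDl addrCA [h *: 1]mulr1.
have dv : derivable f (y + s *: v) v by exact: diff_derivable.
by apply: DeriveDef; rewrite /derivable /derive fE.
Qed.

Lemma MVT_line f y v (t : R) : 0 < t ->
  (forall s, 0 <= s <= t -> differentiable f (y + s *: v)) ->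
  exists2 s, 0 <= s <= t & f (y + t *: v) - f y = t * 'D_v f (y + s *: v).
Proof.
move=> t0 df.
have dF s : 0 <= s <= t ->
    is_derive s 1 (fun s : R => f (y + s *: v)) ('D_v f (y + s *: v)).
  by move=> /df; exact: is_derive_line.
have [s|s|s st E] := @MVT_segment _ (fun s : R => f (y + s *: v))
  (fun s => 'D_v f (y + s *: v)) 0 t (ltW t0).
- by rewrite in_itv /= => /andP[s0 st]; apply: dF; rewrite !ltW.
- apply: derivable_within_continuous => {}s; rewrite in_itv /= => /dF [].
  by [].
- by exists s => //; move: E; rewrite scale0r addr0 subr0 mulrC.
Qed.

Lemma differentiable_translate f u y :
  differentiable f (y + u) -> differentiable (fun z => f (z + u)) y.
Proof.
by move=> df; apply: (differentiable_comp (f := fun z => z + u)).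
Qed.

Lemma derive_translate f u y v : 'D_v (fun z => f (z + u)) y = 'D_v f (y + u).
Proof.
by rewrite /derive; under eq_fun do rewrite /= -addrA.
Qed.

(** Two applications of the mean value theorem, along [v] to the increment
    [z |-> f (z + t w) - f z] and then along [w] to ['D_v f], show that the double
    increment of [f] is [t ^ 2] times ['D_w ('D_v f)] at a point which tends to [x]
    with [t]. *)
Lemma double_increment (U : set V) f x v w (e : R) :
  open U -> Ck 2 f U -> U x -> 0 < e ->
  exists2 d : R, 0 < d & forall t, 0 < t < d ->
    `|(f (x + t *: v + t *: w) - f (x + t *: v) - (f (x + t *: w) - f x))
       - t * t * 'D_w ('D_v f) x| < t * t * e.
Proof.
move=> oU [df dvf] Ux e0.
have [dDf dwf] := dvf v; have /cvgrPdist_lt/(_ e e0) cD := dwf w x Ux.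
have /nbhs_ballP[d d0 xd] : \forall y \near x,
    U y /\ `|'D_w ('D_v f) x - 'D_w ('D_v f) y| < e.
  by near=> y; split; near: y => //; exact: open_nbhs_nbhs.
(* The added 1 keeps the quotient meaningful when [v = w = 0]. *)
have vw0 : 0 < `|v| + `|w| + 1 by rewrite ltr_wpDl// addr_ge0.
exists (d / (`|v| + `|w| + 1)); first by rewrite divr_gt0.
move=> t /andP[t0 td].
have close r s : 0 <= r <= t -> 0 <= s <= t ->
    U (x + r *: v + s *: w) /\
    `|'D_w ('D_v f) x - 'D_w ('D_v f) (x + r *: v + s *: w)| < e.
  move=> /andP[r0 rt] /andP[s0 st]; apply: xd.
  rewrite -ball_normE /= -addrA opprD addrA subrr add0r normrN.
  rewrite (le_lt_trans (ler_normD _ _))// !normrZ !ger0_norm//.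
  move: td; rewrite ltr_pdivlMr//; apply: le_lt_trans.
  rewrite !mulrDr mulr1; apply: ler_wpDr; first exact: ltW.
  by rewrite lerD// ler_wpM2r.
have t0t : 0 <= t <= t by rewrite lexx ltW.
have z0t : 0 <= (0 : R) <= t by rewrite lexx ltW.
have dF s : 0 <= s <= t -> differentiable f (x + s *: v + t *: w).
  by move=> st; apply: df; have [] := close _ _ st t0t.
have dF0 s : 0 <= s <= t -> differentiable f (x + s *: v).
  move=> st; apply: df; have [] := close _ _ st z0t.
  by rewrite scale0r addr0.
pose F z := f (z + t *: w) - f z.
have [s st|s st FE] := @MVT_line F x v t t0.
  by apply: differentiableB; [apply: differentiable_translate; exact: dF|exact: dF0].
have [r rt|r rt DE] := @MVT_line ('D_v f) (x + s *: v) w t t0.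
  by apply: dDf; have [] := close _ _ st rt.
have FE' : 'D_v F (x + s *: v) = 'D_v f (x + s *: v + t *: w) - 'D_v f (x + s *: v).
  rewrite deriveB ?derive_translate//; apply: diff_derivable; last exact: dF0.
  by apply: differentiable_translate; exact: dF.
rewrite -[X in `|X - _|]/(F (x + t *: v) - F x) FE FE' DE.
rewrite mulrA -mulrBr normrM gtr0_norm ?mulr_gt0// ltr_pM2l ?mulr_gt0//.
by rewrite distrC; have [] := close _ _ st rt.
Unshelve. all: by end_near. Qed.

(** The double increment is symmetric in [v] and [w], so its quotient by [t ^ 2]
    has both iterated derivatives as its limit. *)
Lemma schwarz (U : set V) f x v w :
  open U -> Ck 2 f U -> U x -> 'D_w ('D_v f) x = 'D_v ('D_w f) x.
Proof.
move=> oU fU Ux; apply/eqP; rewrite -subr_eq0 -normr_le0.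
apply/ler_addgt0Pr => e e0; rewrite add0r.
have e2 : 0 < e / 2 by rewrite divr_gt0.
have [d1 d10 H1] := double_increment v w oU fU Ux e2.
have [d2 d20 H2] := double_increment w v oU fU Ux e2.
pose t := Num.min d1 d2 / 2.
have m0 : 0 < Num.min d1 d2 by rewrite lt_min d10.
have t0 : 0 < t by rewrite divr_gt0.
have : t < Num.min d1 d2 by rewrite /t ltr_pdivrMr// ltr_pMr// ltr1n.
rewrite lt_min => /andP[td1 td2].
have {H1} := H1 t; rewrite t0 td1 => /(_ isT) H1.
have {H2} := H2 t; rewrite t0 td2 => /(_ isT) H2.
have tt0 : 0 < t * t by rewrite mulr_gt0.
rewrite -(ler_pM2l tt0) -[in leLHS](gtr0_norm tt0) -normrM.
set a := 'D_w _ x in H1 *; set b := 'D_v _ x in H2 *.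
move: H1 H2; rewrite (addrAC x (t *: w)).
set p := f _; set q := f (x + t *: v); set s := f (x + t *: w); set z := f x.
move=> H1 H2; rewrite (splitr e) [in leRHS]mulrDr.
have -> : t * t * (a - b) =
    (p - s - (q - z) - t * t * b) - (p - q - (s - z) - t * t * a) by ring.
apply: le_trans (ler_normB _ _) _; rewrite addrC.
by apply: lerD; apply: ltW; [exact: H1|exact: H2].
Qed.

End Schwarz.

(** * Differentiability of the inverse matrix *)

Section MatrixDifferentiable.
Context {R : realType} {V : normedModType R}.

Lemma differentiable_prod (I : Type) (r : seq I) (f : I -> V -> R) x :
  (forall i, differentiable (f i) x) ->
  differentiable (fun y => \prod_(i <- r) f i y) x.
Proof.
move=> df; elim: r => [|i r IH].
  rewrite (_ : (fun _ => _) = cst 1); last by apply/funext => y; rewrite big_nil.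
  exact: differentiable_cst.
rewrite (_ : (fun _ => _) = f i * (fun y => \prod_(i <- r) f i y)).
  exact: differentiableM.
by apply/funext => y; rewrite big_cons.
Qed.

Lemma differentiable_bigsum (I : Type) (r : seq I) (f : I -> V -> R) x :
  (forall i, differentiable (f i) x) ->
  differentiable (fun y => \sum_(i <- r) f i y) x.
Proof.
move=> df; elim: r => [|i r IH].
  rewrite (_ : (fun _ => _) = cst 0); last by apply/funext => y; rewrite big_nil.
  exact: differentiable_cst.
rewrite (_ : (fun _ => _) = f i + (fun y => \sum_(i <- r) f i y)).
  exact: differentiableD.
by apply/funext => y; rewrite big_cons.
Qed.

Lemma differentiable_det n (G : V -> 'M[R]_n) x :
  (forall i j, differentiable (fun y => G y i j) x) ->
  differentiable (fun y => \det (G y)) x.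
Proof.
move=> dG; apply: differentiable_bigsum => s.
apply: (differentiableM (f := cst _)) => //.
exact: differentiable_prod.
Qed.

Lemma differentiable_invmx n (U : set V) (G : V -> 'M[R]_n) x :
  open U -> U x -> (forall y, U y -> G y \in unitmx) ->
  (forall i j, differentiable (fun y => G y i j) x) ->
  forall i j, differentiable (fun y => invmx (G y) i j) x.
Proof.
move=> oU Ux uG dG i j.
have ddet := differentiable_det dG.
have detG : \det (G x) != 0 by rewrite -unitfE -unitmxE uG.
have dadj : differentiable (fun y => \adj (G y) i j) x.
  rewrite (_ : (fun _ => _) =
      cst ((-1) ^+ (j + i)) * (fun y => \det (row' j (col' i (G y))))).
    apply: differentiableM => //; apply: differentiable_det => k l.
    by under eq_fun do rewrite !mxE.
  by apply/funext => y; rewrite mxE /cofactor.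
apply: near_eq_differentiable (differentiableM (differentiableV ddet detG) dadj).
apply: (near_open oU Ux) => y Uy.
by rewrite /invmx uG// [RHS]mxE.
Qed.

End MatrixDifferentiable.

(** * Bilinear forms *)

Section Bilin.
Context {R : realType} {n : nat}.
Implicit Types (G : 'M[R]_n) (v w : 'rV[R]_n).

Lemma bilinE G v w : bilin G v w = (v *m G *m w^T) 0 0.
Proof.
rewrite /bilin mxE exchange_big; apply: eq_bigr => j _ /=.
rewrite !mxE mulr_suml; apply: eq_bigr => m _.
by rewrite [v 0 m * _]mulrC.
Qed.

Lemma bilin_row m1 m2 G (A : 'M[R]_(m1, n)) (B : 'M[R]_(m2, n)) i j :
  (A *m G *m B^T) i j = bilin G (row i A) (row j B).
Proof.
rewrite bilinE -row_mul [LHS]mxE [RHS]mxE; apply: eq_bigr => k _.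
by congr (_ * _); rewrite !mxE.
Qed.

Lemma bilinDl G v1 v2 w : bilin G (v1 + v2) w = bilin G v1 w + bilin G v2 w.
Proof. by rewrite !bilinE !mulmxDl mxE. Qed.

Lemma bilinZl G c v w : bilin G (c *: v) w = c * bilin G v w.
Proof. by rewrite !bilinE -!scalemxAl mxE. Qed.

Lemma bilinC G v w : G^T = G -> bilin G v w = bilin G w v.
Proof.
move=> sG; rewrite !bilinE -[in RHS]sG -[w in RHS]trmxK -mulmxA -!trmx_mul mulmxA.
by rewrite [in RHS]mxE.
Qed.

Lemma bilinDr G v w1 w2 : bilin G v (w1 + w2) = bilin G v w1 + bilin G v w2.
Proof. by rewrite !bilinE linearD /= mulmxDr mxE. Qed.

Lemma bilinZr G c v w : bilin G v (c *: w) = c * bilin G v w.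
Proof. by rewrite !bilinE linearZ /= -scalemxAr mxE. Qed.

Lemma bilin_suml G (I : finType) (v : I -> 'rV[R]_n) w :
  bilin G (\sum_i v i) w = \sum_i bilin G (v i) w.
Proof.
apply: (big_ind2 (fun x y => bilin G x w = y)) => //.
  by rewrite bilinE !mul0mx mxE.
by move=> x1 y1 x2 y2 <- <-; exact: bilinDl.
Qed.

Lemma posdef_unitmx G : posdef G -> G \in unitmx.
Proof.
move=> [_ pG]; rewrite -row_free_unit -kermx_eq0; apply/rowV0P => v /sub_kermxP vG.
by apply/eqP; apply: contraT => /pG; rewrite bilinE vG mul0mx mxE ltxx.
Qed.

(** Strict Cauchy-Schwarz inequality: the vector [<X, X> Y - <X, Y> X] is nonzero,
    and its square is [<X, X>] times the Gram determinant. *)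
Lemma posdef_gram_gt0 G X Y : posdef G -> row_free (col_mx X Y) ->
  0 < bilin G X X * bilin G Y Y - bilin G X Y ^+ 2.
Proof.
move=> [sG pG] fXY.
have lin0 (s t : R) : s *: X + t *: Y = 0 -> s = 0 /\ t = 0.
  move=> st0; have : row_mx s%:M t%:M *m col_mx X Y = 0 *m col_mx X Y.
    by rewrite mul_row_col !mul_scalar_mx st0 mul0mx.
  move/(row_free_inj fXY); rewrite -row_mx0 => /eq_row_mx[].
  by move=> /matrixP/(_ 0 0) + /matrixP/(_ 0 0); rewrite !mxE !mulr1n.
have X0 : X != 0.
  apply/eqP => X0; have [] := lin0 1 0; last by move/eqP; rewrite oner_eq0.
  by rewrite X0 scaler0 scale0r addr0.
have XX := pG X X0.
have : bilin G X X *: Y - bilin G X Y *: X != 0.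
  apply/eqP => Z0; have [] := lin0 (- bilin G X Y) (bilin G X X).
    by rewrite addrC scaleNr.
  by move=> _ /eqP; rewrite gt_eqF.
move/pG; rewrite -scaleNr !(bilinDl, bilinDr, bilinZl, bilinZr) (bilinC Y X sG).
set x := bilin G X X in XX *; set y := bilin G Y Y; set z := bilin G X Y.
rewrite [ltRHS](_ : _ = x * (x * y - z ^+ 2)); last by ring.
by rewrite pmulr_rgt0.
Qed.
End Bilin.

Section Pairing.
Context {R : realType} {n m : nat} (a : 'M[R]_m).
Implicit Types (f g : 'I_m -> 'rV[R]_n -> R) (u : 'rV[R]_n) (i j k l : 'I_n).

Definition partials i f := fun q => partial i (f q).

(** The vector fields along a map are families of scalar components, so that only
    the calculus of scalar functions is involved. *)
Definition pairing f g u := bilin a (\row_q f q u) (\row_q g q u).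

Lemma pairingC f g u : a^T = a -> pairing f g u = pairing g f u.
Proof. by move=> sa; exact: bilinC. Qed.

Let pairing_sum f g : pairing f g =
  \sum_(p < m) \sum_(q < m) (cst (a p q) * (f p * g q)).
Proof.
apply/funext => u; rewrite fct_sumE; apply: eq_bigr => p _.
by rewrite fct_sumE; apply: eq_bigr => q _; rewrite !mxE mulrA.
Qed.

Lemma partial_pairing f g i u :
  (forall q, differentiable (f q) u) -> (forall q, differentiable (g q) u) ->
  partial i (pairing f g) u = pairing (partials i f) g u + pairing f (partials i g) u.
Proof.
move=> df dg; rewrite pairing_sum.
have F p : derivable (f p) u (delta_mx 0 i) by exact: diff_derivable.
have H p : derivable (g p) u (delta_mx 0 i) by exact: diff_derivable.
have FH p q : derivable (f p * g q) u (delta_mx 0 i) by exact: derivableM.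
have aFH p q : derivable (cst (a p q) * (f p * g q)) u (delta_mx 0 i).
  by apply: derivableM.
have sFH p : derivable (\sum_q cst (a p q) * (f p * g q)) u (delta_mx 0 i).
  exact: derivable_sum (aFH p).
rewrite /partial (derive_sum sFH).
rewrite /pairing /bilin -big_split; apply: eq_bigr => p _ /=.
rewrite (derive_sum (aFH p)) -big_split; apply: eq_bigr => q _ /=.
rewrite deriveM// derive_cst scaler0 addr0 deriveM// !mxE.
rewrite /partials /partial /cst.
set x := 'D_ _ (f p) u; set y := 'D_ _ (g q) u.
(* The product rule scales in [R] as a module over itself, which [ring] does not
   recognize as multiplication. *)
change (a p q * (f p u * y + g q u * x) = a p q * x * g q u + a p q * f p u * y).
ring.
Qed.

Lemma differentiable_pairing f g u :
  (forall q, differentiable (f q) u) -> (forall q, differentiable (g q) u) ->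
  differentiable (pairing f g) u.
Proof.
move=> df dg; rewrite pairing_sum.
apply: differentiable_sum => p; apply: differentiable_sum => q.
by apply: differentiableM => //; apply: differentiableM.
Qed.
End Pairing.

(** * Curvature of a metric induced from a sphere *)

Section Sphere.
Context {R : realType} {n : nat} (V : set 'rV[R]_n) (a : 'M[R]_(1 + n)).
Variables (psi : 'I_(1 + n) -> 'rV[R]_n -> R) (G : 'rV[R]_n -> 'M[R]_n) (C : R).
Hypotheses (oV : open V) (sa : a^T = a) (C0 : C != 0).
Hypothesis psiC3 : forall q, Ck 3 (psi q) V.
Hypothesis sphere : forall u, V u -> pairing a psi psi u = C^-1.
Hypothesis GE : forall u i j, V u ->
  G u i j = pairing a (partials i psi) (partials j psi) u.
Hypothesis unitG : forall u, V u -> G u \in unitmx.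
Implicit Types (u : 'rV[R]_n) (i j k l p : 'I_n) (q : 'I_(1 + n)).

Local Notation Gamma := (christoffel G).

Let dpsi u q : V u -> differentiable (psi q) u.
Proof. by move=> Vu; have [+ _] := psiC3 q; apply. Qed.

Let psiC2 i q : Ck 2 (partials i psi q) V.
Proof. by have [_] := psiC3 q; apply. Qed.

Let dpsi1 u i q : V u -> differentiable (partials i psi q) u.
Proof. by move=> Vu; have [+ _] := psiC2 i q; apply. Qed.

Let dpsi2 u i j q : V u -> differentiable (partials i (partials j psi) q) u.
Proof.
by move=> Vu; have [_ /(_ (delta_mx 0 i))[+ _]] := psiC2 j q; apply.
Qed.

Let psi2C u i j q : V u ->
  partials i (partials j psi) q u = partials j (partials i psi) q u.
Proof.
by move=> Vu; apply: (schwarz _ _ oV _ Vu); apply: CkW; exact: psiC3.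
Qed.

Let psi3C u i j k q : V u ->
  partials i (partials j (partials k psi)) q u =
  partials j (partials i (partials k psi)) q u.
Proof. by move=> Vu; apply: (schwarz _ _ oV _ Vu); exact: psiC2. Qed.

Let pairing_eq f f' g g' u :
  (forall q, f q u = f' q u) -> (forall q, g q u = g' q u) ->
  pairing a f g u = pairing a f' g' u.
Proof.
by move=> ff' gg'; congr (bilin a _ _); apply/rowP => q; rewrite !mxE.
Qed.

Let partial_eq i (f g : 'rV[R]_n -> R) u : V u -> (forall v, V v -> f v = g v) ->
  partial i f u = partial i g u.
Proof. by move=> Vu fg; apply: near_eq_derive; exact: near_open fg. Qed.

Let psi_orth u i : V u -> pairing a psi (partials i psi) u = 0.
Proof.
move=> Vu; have := partial_eq i Vu sphere.
rewrite /partial derive_cst -/(partial i _ u).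
rewrite partial_pairing//; [|by move=> q; exact: dpsi..].
rewrite (pairingC (partials i psi) _ _ sa) -mulr2n => /eqP.
by rewrite mulrn_eq0/= => /eqP.
Qed.

Let psi_second u i j : V u -> pairing a psi (partials i (partials j psi)) u = - G u i j.
Proof.
move=> Vu; have := partial_eq i Vu (fun v Vv => psi_orth j Vv).
rewrite /partial derive_cst -/(partial i _ u).
rewrite partial_pairing//; [|by move=> q; exact: dpsi|by move=> q; exact: dpsi1].
by rewrite -GE// => /eqP; rewrite addrC addr_eq0 => /eqP.
Qed.

Let partialG u i j k : V u -> partial k (fun v => G v i j) u =
  pairing a (partials k (partials i psi)) (partials j psi) u
  + pairing a (partials i psi) (partials k (partials j psi)) u.
Proof.
move=> Vu; rewrite (partial_eq k Vu (fun v => GE i j (u:=v))).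
by rewrite partial_pairing// => q; exact: dpsi1.
Qed.

Let dG u i j : V u -> differentiable (fun v => G v i j) u.
Proof.
move=> Vu.
apply: (@near_eq_differentiable _ _ _ (pairing a (partials i psi) (partials j psi))).
  by apply: (near_open oV Vu) => v Vv; rewrite GE.
by apply: differentiable_pairing => q; exact: dpsi1.
Qed.

(** In an induced metric the first-kind Christoffel symbols are the products
    [<psi_ij, psi_k>]: the three derivatives of [G] give six products, of which
    the symmetry of second derivatives cancels four and identifies two. *)
Let christoffelE u l i j : V u -> Gamma l i j u =
  \sum_k invmx (G u) l k * pairing a (partials i (partials j psi)) (partials k psi) u.
Proof.
move=> Vu; rewrite /christoffel mulr_sumr; apply: eq_bigr => k _.
rewrite mulrCA; congr (_ * _).
rewrite (partialG k j i Vu) (partialG k i j Vu) (partialG i j k Vu).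
(* [x1] to [x6] are the products in the order in which they stand in the goal:
   [<ik,j>], [<k,ij>], [<jk,i>], [<k,ji>], [<ki,j>] and [<i,kj>]. *)
have alg (x1 x2 x3 x4 x5 x6 : R) : x5 = x1 -> x6 = x3 -> x4 = x2 ->
    2^-1 * (x1 + x2 + (x3 + x4) - (x5 + x6)) = x2 by move=> -> -> ->; field.
rewrite alg; first exact: pairingC.
- by apply: pairing_eq => q; first exact: psi2C.
- rewrite [LHS](pairingC _ _ _ sa).
  by apply: pairing_eq => q; first exact: psi2C.
- by apply: pairing_eq => q; last exact: psi2C.
Qed.

(** By [christoffelE] the Christoffel symbols are built from [G], whose inverse is
    differentiable, and from first and second derivatives of [psi], which are
    differentiable because [psi] is [C^3]. *)
Let dGamma u l i j : V u -> differentiable (Gamma l i j) u.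
Proof.
move=> Vu.
apply: (@near_eq_differentiable _ _ _ (fun v => \sum_k invmx (G v) l k *
   pairing a (partials i (partials j psi)) (partials k psi) v)).
  by apply: (near_open oV Vu) => v Vv; rewrite christoffelE.
apply: differentiable_bigsum => k; apply: differentiableM.
  by apply: (differentiable_invmx oV Vu unitG) => r s; exact: dG.
by apply: differentiable_pairing => q; [exact: dpsi2|exact: dpsi1].
Qed.

(** The position vector, normal to the sphere, followed by the coordinate
    tangent vectors. *)
Let frame u : 'M[R]_(1 + n) :=
  col_mx (\row_q psi q u) (\matrix_(i, q) partials i psi q u).

(** The position vector is orthogonal to the tangent vectors, so the Gram matrix
    is block diagonal, and invertible. *)
Let frame_gram u : V u ->
  frame u *m a *m (frame u)^T = block_mx (C^-1)%:M 0 0 (G u).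
Proof.
move=> Vu; have PP (f g : 'I_(1 + n) -> 'rV[R]_n -> R) :
    bilin a (\row_q f q u) (\row_q g q u) = pairing a f g u by [].
have rowd i : row i (\matrix_(i, q) partials i psi q u) = \row_q partials i psi q u.
  by apply/rowP => q; rewrite !mxE.
have row0 (v : 'rV[R]_(1 + n)) (i : 'I_1) : row i v = v.
  by apply/rowP => q; rewrite ord1 mxE.
rewrite /frame tr_col_mx mul_col_mx mul_col_row; congr block_mx;
    apply/matrixP => i j; rewrite bilin_row ?rowd ?row0 PP.
- by rewrite sphere// !ord1 mxE mulr1n.
- by rewrite psi_orth// mxE.
- by rewrite pairingC// psi_orth// mxE.
- by rewrite GE.
Qed.

Let unit_frame_a u : V u -> frame u \in unitmx /\ a \in unitmx.
Proof.
move=> Vu; have : \det (frame u *m a *m (frame u)^T) != 0.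
  rewrite frame_gram// det_ublock det_scalar expr1 mulf_neq0 ?invr_eq0//.
  by rewrite -unitfE -unitmxE unitG.
rewrite !det_mulmx !mulf_eq0 !negb_or !unitmxE !unitfE.
by move=> /andP[/andP[]].
Qed.

(** Both the frame and [a] are invertible matrices; this reduces identities
    between vectors to identities between products of [psi] and its derivatives. *)
Let frame_ext u (v w : 'rV[R]_(1 + n)) : V u ->
  bilin a v (\row_q psi q u) = bilin a w (\row_q psi q u) ->
  (forall p, bilin a v (\row_q partials p psi q u) =
             bilin a w (\row_q partials p psi q u)) -> v = w.
Proof.
move=> Vu v0 vp; have : v *m a *m (frame u)^T = w *m a *m (frame u)^T.
  rewrite /frame tr_col_mx !mul_mx_row; congr row_mx.
    by apply/matrixP => i j; rewrite !ord1 -!bilinE.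
  apply/rowP => p; rewrite !bilin_row.
  have -> : row p (\matrix_(i, q) partials i psi q u) = \row_q partials p psi q u.
    by apply/rowP => q; rewrite !mxE.
  have row0 (z : 'rV[R]_(1 + n)) (i : 'I_1) : row i z = z.
    by apply/rowP => q; rewrite ord1 mxE.
  by rewrite !row0.
have [uf ua] := unit_frame_a Vu; rewrite -unitmx_tr in uf.
by move/(can_inj (mulmxK uf))/(can_inj (mulmxK ua)).
Qed.

(** Gauss formula: both sides have the same products with the frame, by
    [psi_second] for the normal direction and by [christoffelE] for the tangent
    ones. *)
Let gauss u i j q : V u -> partials i (partials j psi) q u =
  \sum_l Gamma l i j u * partials l psi q u - C * G u i j * psi q u.
Proof.
move=> Vu; pose T l : 'rV[R]_(1 + n) := \row_q partials l psi q u.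
pose X : 'rV[R]_(1 + n) := \row_q psi q u.
suff : \row_q partials i (partials j psi) q u =
    \sum_l Gamma l i j u *: T l + (- C * G u i j) *: X.
  move/rowP/(_ q); rewrite !mxE summxE => ->; rewrite !mulNr; congr (_ - _).
  by apply: eq_bigr => l _; rewrite !mxE.
apply: (frame_ext Vu) => [|p]; rewrite bilinDl bilin_suml bilinZl.
  rewrite -/(pairing _ _ _ _) pairingC// psi_second// -/(pairing _ _ _ _) sphere//.
  rewrite big1 ?add0r => [|l _]; last first.
    by rewrite bilinZl -/(pairing _ _ _ _) pairingC// psi_orth// mulr0.
  by rewrite mulrAC mulNr divff// mulN1r.
rewrite -[bilin a X _]/(pairing a psi (partials p psi) u) psi_orth// mulr0 addr0.
under eq_bigr => l _.
  rewrite bilinZl christoffelE//.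
  rewrite -[bilin _ _ _]/(pairing a (partials l psi) (partials p psi) u).
  rewrite -GE// mulr_suml; over.
rewrite exchange_big /=.
under eq_bigr => k _.
  under eq_bigr => l _ do rewrite mulrAC.
  rewrite -mulr_suml.
  have -> : \sum_l invmx (G u) l k * G u l p = (k == p)%:R.
    have GT : (G u)^T = G u.
      apply/matrixP => r s; rewrite mxE [LHS](GE _ _ Vu) [RHS](GE _ _ Vu).
      exact: pairingC.
    have := mulmxV (unitG Vu) => /matrixP/(_ p k).
    rewrite !mxE eq_sym => <-; apply: eq_bigr => l _.
    by rewrite mulrC -{1}GT mxE.
  over.
rewrite (bigD1 p)//= eqxx mul1r big1 ?addr0// => k /negbTE->.
by rewrite mul0r.
Qed.

(** Components in the frame of the derivative along [i] of the Gauss formula for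
    [psi_jk], once the second derivatives that it contains are expanded again. *)
Let normal_coef i j k u : R :=
  - C * (\sum_l Gamma l j k u * G u i l + partial i (fun v => G v j k) u).

Let tangent_coef l i j k u : R :=
  partial i (Gamma l j k) u + \sum_p Gamma l i p u * Gamma p j k u
  - C * G u j k * (l == i)%:R.

Let partial_gauss u i j k q : V u -> partials i (partials j (partials k psi)) q u =
  \sum_l (partial i (Gamma l j k) u * partials l psi q u
           + Gamma l j k u * partials i (partials l psi) q u)
  - C * (partial i (fun v => G v j k) u * psi q u + G u j k * partials i psi q u).
Proof.
move=> Vu; rewrite {1}/partials.
rewrite (partial_eq (g := (\sum_l Gamma l j k * partials l psi q)
   - cst C * ((fun v => G v j k) * psi q)) i Vu); last first.
  move=> v Vv; rewrite gauss// !fctE fct_sumE; congr (_ - _).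
  by rewrite -mulrA.
have D1 (f : 'rV[R]_n -> R) : differentiable f u -> derivable f u (delta_mx 0 i).
  exact: diff_derivable.
have DGamma l := D1 _ (dGamma l j k Vu).
have Dp l := D1 _ (dpsi1 l q Vu).
have DG := D1 _ (dG j k Vu).
have Dpsi := D1 _ (dpsi q Vu).
have DGp l : derivable (Gamma l j k * partials l psi q) u (delta_mx 0 i).
  exact: derivableM (DGamma l) (Dp l).
have DGpsi : derivable ((fun v => G v j k) * psi q) u (delta_mx 0 i).
  exact: derivableM DG Dpsi.
have DCG : derivable (cst C * ((fun v => G v j k) * psi q)) u (delta_mx 0 i).
  exact: derivableM (derivable_cst _ _ _) DGpsi.
rewrite {1}/partial (deriveB (derivable_sum DGp) DCG) (derive_sum DGp).
congr (_ - _).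
  apply: eq_bigr => l _; rewrite (deriveM (DGamma l) (Dp l)) addrC.
  by congr (_ + _); rewrite [LHS]mulrC.
rewrite (deriveM (derivable_cst _ _ _) DGpsi) derive_cst scaler0 addr0.
rewrite (deriveM DG Dpsi) addrC; congr (_ * (_ + _)).
by rewrite [LHS]mulrC.
Qed.

Let psi3E u i j k q : V u -> partials i (partials j (partials k psi)) q u =
  \sum_l tangent_coef l i j k u * partials l psi q u + normal_coef i j k u * psi q u.
Proof.
move=> Vu; rewrite partial_gauss//.
under eq_bigr => l _ do rewrite gauss// mulrBr.
rewrite big_split sumrB /=.
have -> : \sum_l Gamma l j k u * \sum_p Gamma p i l u * partials p psi q u =
    \sum_l (\sum_p Gamma l i p u * Gamma p j k u) * partials l psi q u.
  under eq_bigr => l _ do rewrite mulr_sumr.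
  rewrite exchange_big; apply: eq_bigr => l _; rewrite mulr_suml.
  by apply: eq_bigr => p _ /=; rewrite mulrA [Gamma p j k u * _]mulrC.
have -> : \sum_l tangent_coef l i j k u * partials l psi q u =
    \sum_l partial i (Gamma l j k) u * partials l psi q u
    + \sum_l (\sum_p Gamma l i p u * Gamma p j k u) * partials l psi q u
    - C * G u j k * partials i psi q u.
  rewrite /tangent_coef; under eq_bigr => l _ do rewrite mulrBl mulrDl.
  rewrite sumrB big_split /=; congr (_ - _).
  rewrite (bigD1 i)//= eqxx mulr1 big1 ?addr0// => l /negbTE->.
  by rewrite mulr0 mul0r.
have -> : \sum_l Gamma l j k u * (C * G u i l * psi q u) =
    C * (\sum_l Gamma l j k u * G u i l) * psi q u.
  rewrite mulr_sumr mulr_suml; apply: eq_bigr => l _.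
  by move: (christoffel _ _ _ _ _) (G u i l) (psi q u) => x y z; ring.
rewrite /normal_coef.
set x := \sum_l partial _ (Gamma l j k) _ * _; set y := \sum_l (\sum_p _) * _.
set z := \sum_l _ * G _ _ _; set w := partial _ _ _; set t := partials i psi q u.
ring.
Qed.

Let frame_free u (c : 'I_n -> R) (s : R) : V u ->
  (forall q, \sum_l c l * partials l psi q u + s * psi q u = 0) -> forall l, c l = 0.
Proof.
move=> Vu cs l; have [uf _] := unit_frame_a Vu.
have : row_mx s%:M (\row_l c l) *m frame u = 0.
  rewrite /frame mul_row_col mul_scalar_mx; apply/rowP => q.
  rewrite !mxE addrC -[RHS](cs q); congr (_ + _).
  by apply: eq_bigr => p _; rewrite !mxE.
move/(congr1 (mulmx^~ (invmx (frame u)))); rewrite mulmxK// mul0mx -row_mx0.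
by move/eq_row_mx => [_ /rowP/(_ l)]; rewrite !mxE.
Qed.

(** The tangential components of the vanishing vector [psi_ijk - psi_jik] are the
    differences between the curvature tensor and the right-hand side. *)
Lemma riemann_sphere u l k i j : V u ->
  riemann G l k i j u = C * (G u j k * (l == i)%:R - G u i k * (l == j)%:R).
Proof.
move=> Vu; pose c l := tangent_coef l i j k u - tangent_coef l j i k u.
have cl0 : c l = 0.
  apply: (frame_free (s := normal_coef i j k u - normal_coef j i k u) Vu) => q.
  under eq_bigr => p _ do rewrite mulrBl.
  rewrite sumrB mulrBl addrACA -opprD -!psi3E//.
  by apply/eqP; rewrite subr_eq0; apply/eqP; exact: psi3C.
have -> : riemann G l k i j u =
    c l + C * (G u j k * (l == i)%:R - G u i k * (l == j)%:R).
  rewrite /riemann /c /tangent_coef sumrB.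
  set x := partial _ _ _; set y := partial _ _ _.
  set z := \sum_p _; set w := \sum_p _.
  ring.
by rewrite cl0 add0r.
Qed.

Lemma sectional_curvature_sphere u X Y : V u -> posdef (G u) ->
  row_free (col_mx X Y) -> sectional_curvature G u X Y = C.
Proof.
move=> Vu pG fXY; have gram := posdef_gram_gt0 pG fXY.
have -> : sectional_curvature G u X Y = bilin (G u) (C *: (bilin (G u) Y Y *: X
    - bilin (G u) X Y *: Y)) X /
    (bilin (G u) X X * bilin (G u) Y Y - bilin (G u) X Y ^+ 2).
  congr (bilin _ _ _ / _); apply/rowP => l; rewrite !mxE.
  have -> : \sum_i \sum_j \sum_k riemann G l k i j u * X 0 i * Y 0 j * Y 0 k =
     \sum_i \sum_j \sum_k (C * (X 0 i * (l == i)%:R) * (G u j k * Y 0 j * Y 0 k)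
       - C * (Y 0 j * (l == j)%:R) * (G u i k * X 0 i * Y 0 k)).
    apply: eq_bigr => i _; apply: eq_bigr => j _; apply: eq_bigr => k _.
    rewrite riemann_sphere//; ring.
  under eq_bigr => i _.
    under eq_bigr => j _ do rewrite sumrB -!mulr_sumr.
    rewrite sumrB -mulr_sumr; over.
  rewrite sumrB -mulr_suml -mulr_sumr [X in _ - X]exchange_big /=.
  under [X in _ - X]eq_bigr => j _ do rewrite -mulr_sumr.
  rewrite -mulr_suml -mulr_sumr -!/(bilin _ _ _).
  have delta (Z : 'rV[R]_n) : \sum_i Z 0 i * (l == i)%:R = Z 0 l.
    rewrite (bigD1 l)//= eqxx mulr1 big1 ?addr0// => i; rewrite eq_sym => /negbTE->.
    by rewrite mulr0.
  rewrite !delta; ring.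
rewrite bilinZl bilinDl -scaleNr !bilinZl (bilinC Y X) ?(proj1 pG)//.
rewrite [X in X / _](_ : _ =
  C * (bilin (G u) X X * bilin (G u) Y Y - bilin (G u) X Y ^+ 2)); last by ring.
by rewrite mulfK// gt_eqF.
Qed.

End Sphere.

(** * The indicatrix *)

Lemma induced_metricE (R : realType) (N n : nat) (g : 'rV[R]_N -> 'M[R]_N)
    (sigma : 'rV[R]_n -> 'rV[R]_N) (u : 'rV[R]_n) : differentiable sigma u ->
  induced_metric g sigma u = 'J sigma u *m g (sigma u) *m ('J sigma u)^T.
Proof.
move=> ds; apply/matrixP => i j; rewrite mxE bilin_row.
by rewrite /partial !deriveEjacobian// !rowE.
Qed.

Lemma posdef_pullback (R : realType) (N n : nat) (A : 'M[R]_N) (J : 'M[R]_(n, N)) :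
  posdef A -> row_free J -> posdef (J *m A *m J^T).
Proof.
move=> [sA pA] fJ; split=> [|v v0]; first by rewrite !trmx_mul trmxK sA mulmxA.
have vJ0 : v *m J != 0.
  by apply: contraNneq v0 => vJ; apply/eqP/(row_free_inj fJ); rewrite vJ mul0mx.
by have := pA _ vJ0; rewrite !bilinE trmx_mul !mulmxA.
Qed.

(** The chain rule turns the hypothesis on the metric tensor of [F] into the
    statement that the hypersurface metric is the pullback of [a] by [z / h]; on
    [F = 1] the conformal factor reduces to [1 / h]. *)
Lemma induced_metric_indicatrix (R : realType) (N n : nat) (F : 'rV[R]_N -> R)
    (z : 'rV[R]_N -> 'rV[R]_N) (a : 'M[R]_N) (h : R) (sigma : 'rV[R]_n -> 'rV[R]_N) u :
  differentiable sigma u -> differentiable z (sigma u) -> F (sigma u) = 1 ->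
  (let kappa := h^-1 * F (sigma u) `^ (1 - h) in
     forall k l, finsler_tensor F (sigma u) k l =
       kappa ^+ 2 * \sum_i \sum_j
         partial k (fun y => z y 0 i) (sigma u)
         * partial l (fun y => z y 0 j) (sigma u) * a i j) ->
  forall i j, let psi q v := h^-1 * z (sigma v) 0 q in
  induced_metric (finsler_tensor F) sigma u i j =
    pairing a (partials i psi) (partials j psi) u.
Proof.
move=> ds dz F1; rewrite F1 powR1 mulr1 => /= gE i j.
pose Jz := \matrix_(k, q) partial k (fun y => z y 0 q) (sigma u).
have -> : induced_metric (finsler_tensor F) sigma u i j =
    bilin (finsler_tensor F (sigma u)) (partial i sigma u) (partial j sigma u).
  by rewrite mxE.
have -> : finsler_tensor F (sigma u) = h^-1 ^+ 2 *: (Jz *m a *m Jz^T).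
  apply/matrixP => k l; rewrite gE mxE; congr (_ * _); rewrite bilin_row.
  apply: eq_bigr => p _; apply: eq_bigr => q _; rewrite !mxE.
  by rewrite mulrC mulrA.
have dpsi k : \row_q partials k (fun q v => h^-1 * z (sigma v) 0 q) q u =
    h^-1 *: (partial k sigma u *m Jz).
  apply/rowP => q; rewrite !mxE /partials.
  have dzq : differentiable (fun y => z y 0 q) (sigma u).
    apply: (differentiable_comp (g := fun y : 'rV[R]_N => y 0 q)) => //.
    exact: differentiable_coord.
  rewrite {1}/partial.
  have := derive_comp_partial (delta_mx 0 k) ds dzq; rewrite /comp => dE.
  have dzs : derivable (fun v => z (sigma v) 0 q) u (delta_mx 0 k).
    apply: diff_derivable.
    exact: (differentiable_comp (g := fun y => z y 0 q)).
  rewrite [LHS](deriveMl h^-1 dzs) dE; congr (_ * _).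
  by apply: eq_bigr => l _; rewrite mxE.
rewrite /pairing (dpsi i) (dpsi j) bilinZl bilinZr mulrA -expr2.
rewrite !bilinE -scalemxAr -scalemxAl mxE.
by rewrite trmx_mul !mulmxA.
Qed.

Unset Implicit Arguments.

Theorem theorem2p2 (R : realType) (N : nat) (M : topologicalType)
    (A : set (chart R N M))
    (K : chart R N M -> M -> 'rV[R]_N -> R)
    (a : chart R N M -> M -> 'M[R]_N)
    (D : chart R N M -> M -> set 'rV[R]_N)
    (zeta : chart R N M -> M -> 'rV[R]_N -> 'rV[R]_N)
    (h : M -> R) :
  smooth_manifold A ->
  finsler_metric A K ->
  riemannian_metric A a ->
  fibrewise_transformation A D zeta ->
  (forall p, 0 < h p) ->
  (forall c p y t, A c -> dom c p -> D c p y -> 0 < t ->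
     zeta c p (t *: y) = t `^ h p *: zeta c p y) ->
  (forall c p y, A c -> dom c p -> D c p y ->
     K c p y = 1 <-> riem_norm (a c p) (zeta c p y) = 1) ->
  (forall c p y, A c -> dom c p -> D c p y ->
     let kappa := (h p)^-1 * K c p y `^ (1 - h p) in
     forall m n, finsler_tensor (K c p) y m n =
       kappa ^+ 2 * \sum_i \sum_j
         partial m (fun z => zeta c p z 0 i) y
         * partial n (fun z => zeta c p z 0 j) y * a c p i j) ->
  forall c p, A c -> dom c p ->
    hypersurface_constant_curvature (finsler_tensor (K c p))
      (indicatrix (K c p) `&` D c p) (h p ^+ 2).
Proof.
case: N A K a D zeta => [|n] A K a D zeta _ fin riem ft hpos _ unitE gE c p Ac pc
    V sigma [oV sigma3 imm _ sub] u X Y Vu fXY.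
  (* There are no independent vectors [X] and [Y] in dimension 0. *)
  have : (\rank (col_mx X Y) <= 0)%N by exact: rank_leq_col.
  by move: fXY; rewrite /row_free => /eqP->.
have [sa _] := riem_posdef riem Ac pc.
have h0 := hpos p; have hn0 : h p != 0 by rewrite gt_eqF.
have [oD _ _] := ft_region ft Ac pc.
have [_ [_ _ zeta5 _]] := ft_diffeo ft Ac pc.
have sigmaP v : V v -> [/\ sigma v != 0, K c p (sigma v) = 1 & D c p (sigma v)].
  by move=> Vv; have [[? ?] ?] := sub _ (imageP sigma Vv).
have dsigma v : V v -> differentiable sigma v by move=> Vv; case: sigma3 => + _; apply.
pose psi (q : 'I_(1 + n)) (v : 'rV[R]_n) : R := (h p)^-1 * zeta c p (sigma v) 0 q.
have posG v : V v -> posdef (induced_metric (finsler_tensor (K c p)) sigma v).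
  move=> Vv; rewrite induced_metricE; last exact: dsigma.
  have [s0 _ _] := sigmaP v Vv.
  by apply: posdef_pullback; [exact: (fin_convex fin Ac pc s0)|exact: imm].
apply: (@sectional_curvature_sphere R n V (a c p) psi) => //.
- by rewrite expf_neq0.
- move=> q; apply: CkM => //; first exact: Ck_cst.
  apply: (Ck_comp oV (W := D c p) (g := fun y => zeta c p y 0 q) _ sigma3).
    by move=> v /sigmaP[].
  by apply: Ck_coord => //; do 2 apply: CkW.
- move=> v Vv; have [_ /unitE zE Dv] := sigmaP v Vv.
  have {zE} := zE Ac pc Dv; rewrite /riem_norm => z1.
  have zz : bilin (a c p) (zeta c p (sigma v)) (zeta c p (sigma v)) = 1.
    (* A negative square would have norm 0, not 1. *)
    have z0 : 0 <= bilin (a c p) (zeta c p (sigma v)) (zeta c p (sigma v)).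
      rewrite leNgt; apply/negP => /ltW/ler0_sqrtr z0.
      by move/eqP: z1; rewrite z0 eq_sym oner_eq0.
    by rewrite -[LHS]sqr_sqrtr// z1 expr1n.
  have -> : pairing (a c p) psi psi v = bilin (a c p)
      ((h p)^-1 *: zeta c p (sigma v)) ((h p)^-1 *: zeta c p (sigma v)).
    by congr (bilin _ _ _); apply/rowP => q; rewrite !mxE.
  by rewrite bilinZl bilinZr zz mulr1 -expr2 exprVn.
- move=> v i j Vv; have [_ K1 Dv] := sigmaP v Vv.
  apply: induced_metric_indicatrix => //; first exact: dsigma.
    by have [+ _] := zeta5; apply.
  exact: gE.
- by move=> v /posG; exact: posdef_unitmx.
- exact: posG.
Qed.
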